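(* Let $Y$ be a topological vector space, let $A$ be a closed proper subset of $Y$, let $k\in-0^+A\setminus\{0\}$, and let $y^0\in Y$. Then $y^0+A$ is a closed proper subset of $Y$ with $k\in-0^+(y^0+A)\setminus\{0\}$, $\operatorname{dom}\varphi_{y^0+A,k}=y^0+\operatorname{dom}\varphi_{A,k}$ and $$\varphi_{y^0+A,k}(y)=\varphi_{A,k}(y-y^0)\quad\forall y\in Y.$$ $\varphi_{y^0+A,k}$ is proper, finite-valued, continuous, lower semicontinuous, upper semicontinuous, convex, concave, strictly quasiconvex and affine, respectively, if and only if $\varphi_{A,k}$ has this property. For $B\subset Y$, $\varphi_{y^0+A,k}$ is $B$-monotone and strictly $B$-monotone, respectively, if and only if $\varphi_{A,k}$ has this property.
   Context: Vector spaces are real. ''Proper subset of $Y$'' means nonempty and different from $Y$. $0^+A=\{u\in Y\mid a+tu\in A\ \forall a\in A,\ \forall t\ge0\}$. $\nu$ is a symbolic value not in $\overline{\mathbb{R}}=\mathbb{R}\cup\{\pm\infty\}$, not comparable with elements of $\overline{\mathbb{R}}$, with $-\nu=\nu$; $\inf\emptyset:=\nu$. For $M\subseteq Y$, $\varphi_{M,k}:Y\to\overline{\mathbb{R}}\cup\{\nu\}$, $\varphi_{M,k}(y)=\inf\{t\in\mathbb{R}\mid y\in tk+M\}$. For $\varphi:Y\to\overline{\mathbb{R}}\cup\{\nu\}$: $\operatorname{dom}\varphi=\{y\mid\varphi(y)\in\overline{\mathbb{R}}\}$ (for $\varphi_{M,k}$ the value $+\infty$ does not occur) and $\operatorname{epi}\varphi=\{(y,t)\in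 Y\times\mathbb{R}\mid y\in\operatorname{dom}\varphi,\varphi(y)\le t\}$. $\varphi$ is: proper if $\operatorname{dom}\varphi\neq\emptyset$ and it is real-valued on $\operatorname{dom}\varphi$; finite-valued if real-valued on $Y$; (lower/upper semi-)continuous if its restriction to $\operatorname{dom}\varphi$, as a map into $\overline{\mathbb{R}}$, is so; convex if $\operatorname{dom}\varphi$ and $\operatorname{epi}\varphi$ are convex; concave if $-\varphi$ is convex; affine if convex and concave; strictly quasiconvex if $\operatorname{dom}\varphi$ is convex and $\varphi(cy^1+(1-c)y^2)<\max(\varphi(y^1),\varphi(y^2))$ for all distinct $y^1,y^2\in\operatorname{dom}\varphi$, $c\in(0,1)$. $\varphi$ is $B$-monotone if $y^1,y^2\in\operatorname{dom}\varphi$, $y^2-y^1\in B$ imply $\varphi(y^1)\le\varphi(y^2)$; strictly $B$-monotone if $y^1,y^2\in\operatorname{dom}\varphi$, $y^2-y^1\in B\setminus\{0\}$ imply $\varphi(y^1)<\varphi(y^2)$. *)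

(* Defs.v *)
From mathcomp Require Import all_boot all_order all_algebra.
From mathcomp Require Import all_classical all_reals all_analysis.

Set Implicit Arguments.
Unset Strict Implicit.
Unset Printing Implicit Defensive.

Import Order.TTheory GRing.Theory Num.Theory.
Import numFieldTopology.Exports.

Local Open Scope classical_set_scope.
Local Open Scope ring_scope.

(* The value set (extended reals plus a symbol nu) is [option (\bar R)]:
   [Some x] is the extended real [x] and [None] is nu. *)

Section sets.
Context {R : realType} {Y : lmodType R}.
Implicit Types (A : set Y) (y k : Y).

Definition proper_subset A : Prop := A !=set0 /\ A <> setT.

Definition translate y A : set Y := [set y + a | a in A].

Definition recession_cone A : set Y :=
  [set u | forall a, A a -> forall t : R, 0 <= t -> A (a + t *: u)].

End sets.

Section values.
Context {R : realType}.

Definition inf_nu (S : set R) : option (\bar R) :=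
  if `[< S !=set0 >] then Some (ereal_inf [set t%:E | t in S]) else None.

(* In particular - nu = nu. *)
Definition opp_nu (v : option (\bar R)) : option (\bar R) :=
  omap (fun x => - x)%E v.

End values.

Definition phi {R : realType} {Y : lmodType R} (M : set Y) (k : Y) :
    Y -> option (\bar R) :=
  fun y => inf_nu [set t : R | translate (t *: k) M y].

Section functions.
Context {R : realType} {Y : lmodType R}.
Implicit Types (f : Y -> option (\bar R)) (B : set Y).

Definition dom f : set Y := [set y | exists x, f y = Some x].

(* The restriction of [f] to [dom f] as a map into [\bar R]; the value 0
   outside [dom f] is immaterial: every notion below only
   depends on the values on [dom f]. *)
Definition value f (y : Y) : \bar R := odflt 0%E (f y).

Definition epi f : set (Y * R^o) :=
  [set p | dom f p.1 /\ (value f p.1 <= p.2%:E)%E].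

Definition is_proper f : Prop :=
  dom f !=set0 /\ (forall y, dom f y -> exists r : R, value f y = r%:E).

Definition is_finite_valued f : Prop :=
  forall y, exists r : R, f y = Some r%:E.

Definition is_convex f : Prop :=
  @convex_set R Y (dom f) /\ @convex_set R (Y * R^o)%type (epi f).

Definition is_concave f : Prop := is_convex (fun y => opp_nu (f y)).

Definition is_affine f : Prop := is_convex f /\ is_concave f.

Definition is_strictly_quasiconvex f : Prop :=
  @convex_set R Y (dom f) /\
  forall (y1 y2 : Y) (c : R), dom f y1 -> dom f y2 -> y1 <> y2 ->
    0 < c -> c < 1 ->
    (value f (c *: y1 + (1 - c) *: y2) < maxe (value f y1) (value f y2))%E.

Definition is_monotone B f : Prop :=
  forall y1 y2, dom f y1 -> dom f y2 -> B (y2 - y1) ->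
    (value f y1 <= value f y2)%E.

Definition is_strictly_monotone B f : Prop :=
  forall y1 y2, dom f y1 -> dom f y2 -> (B `\ 0) (y2 - y1) ->
    (value f y1 < value f y2)%E.

End functions.

(* Counterpart of the library's [lower_semicontinuous]. *)
Definition upper_semicontinuous {X : topologicalType} {R : numFieldType}
    (g : X -> \bar R) : Prop :=
  forall x a, (g x < a%:E)%E ->
    exists2 V, nbhs x V & forall y, V y -> (g y < a%:E)%E.

(* Points outside [D] are isolated in [subspace D], so the properties below
   only constrain the restriction of [f] to [dom f], for the induced topology. *)
Section topological_functions.
Context {R : realType} {Y : topologicalLmodType R}.
Implicit Types f : Y -> option (\bar R).

Definition is_continuous f : Prop := {within dom f, continuous (value f)}.

Definition is_lower_semicontinuous f : Prop :=
  lower_semicontinuous (value f : subspace (dom f) -> \bar R).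

Definition is_upper_semicontinuous f : Prop :=
  upper_semicontinuous (value f : subspace (dom f) -> \bar R).

End topological_functions.

(* Main.v *)
Require Import Defs.
From mathcomp Require Import all_boot all_order all_algebra.
From mathcomp Require Import all_classical all_reals all_analysis.

Set Implicit Arguments.
Unset Strict Implicit.
Unset Printing Implicit Defensive.

Import Order.TTheory GRing.Theory Num.Theory.
Import numFieldTopology.Exports.

Local Open Scope classical_set_scope.
Local Open Scope ring_scope.

(** Since [y \in t *: k + (y0 + A)] says the same as
    [y - y0 \in t *: k + A], the two infima run over the same set of
    parameters [t], so [phi (translate y0 A) k] is [phi A k] precomposed with
    the translation [y |-> y - y0] ([phi_translate]).  That translation is an
    affine homeomorphism of [Y] that leaves differences of points unchanged,
    and each property under consideration only depends on data transported by
    such maps: values, convex combinations, the topology, differences.  Hence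
    every property passes from a function [f] to all its translates
    [f \o shift a], and because [f] is itself a translate of [f \o shift a],
    each implication is automatically an equivalence ([shift_invariantP]).

    The semicontinuity notions refer to the restriction of the function to its
    domain.  They are transported because the domain of [f \o h] is the
    preimage under [h] of the domain of [f], and a continuous map [h] remains
    continuous between the corresponding subspaces
    ([continuous_subspace_preimage]). *)

Section translation.
Context {R : realType} {Y : lmodType R}.
Implicit Types (A B : set Y) (f : Y -> option (\bar R)) (a y k : Y).

(** Membership in a preimage is definitional, which spares the later proofs
    the existential hidden in an image. *)
Lemma translateE a A : translate a A = center a @^-1` A.
Proof.
rewrite eqEsubset; split=> [_ [x Ax <-]|y Ay] /=; first by rewrite addrC addKr.
by exists (y - a) => //; rewrite addrC subrK.
Qed.

Lemma proper_subset_translate a A :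
  proper_subset A -> proper_subset (translate a A).
Proof.
move=> [[x Ax] AT]; split; first by exists (a + x), x.
apply: contra_not AT => tAT; rewrite -subTset => y _.
have : translate a A (y + a) by rewrite tAT.
by rewrite translateE /= addrK.
Qed.

(** Recession directions act by addition, which commutes with translating. *)
Lemma recession_cone_translate a A :
  recession_cone (translate a A) = recession_cone A.
Proof.
rewrite translateE eqEsubset; split=> u Au x /= Ax t t0.
  move: (Au (x + a)); rewrite /= addrK => /(_ Ax t t0).
  by rewrite addrAC addrK.
by rewrite addrAC; exact: Au.
Qed.

Lemma phi_translate a A k : phi (translate a A) k = phi A k \o center a.
Proof.
apply/funext => y; rewrite /phi /=; congr inf_nu; apply/seteqP.
by split=> t /=; rewrite !translateE /= addrAC.
Qed.

(** The converse implication is the hypothesis applied to the opposite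
    translation. *)
Lemma shift_invariantP (P : (Y -> option (\bar R)) -> Prop) f a :
  (forall g b, P g -> P (g \o shift b)) -> P (f \o shift a) <-> P f.
Proof.
move=> Pshift; split=> [/(Pshift _ (- a))|]; last exact: Pshift.
by rewrite comp_shiftK.
Qed.

Lemma is_proper_shift f a : is_proper f -> is_proper (f \o shift a).
Proof.
move=> [[x fx] fR]; split=> [|y]; last exact: fR.
by exists (x - a); rewrite /dom /= subrK.
Qed.

Lemma is_finite_valued_shift f a :
  is_finite_valued f -> is_finite_valued (f \o shift a).
Proof. by move=> fR y; exact: fR. Qed.

(** Translations are affine because the weights sum to one. *)
Lemma shift_convex_comb (V : lmodType R) (x y v : V) (c : R) :
  c *: x + (1 - c) *: y + v = c *: (x + v) + (1 - c) *: (y + v).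
Proof.
by rewrite !scalerDr addrACA -scalerDl [c + _]addrC subrK scale1r.
Qed.

Lemma convex_set_shift (V : lmodType R) (C : set V) (v : V) :
  @convex_set R V C -> @convex_set R V (shift v @^-1` C).
Proof.
move=> cC x y l; rewrite !inE => Cx Cy.
have := cC (x + v) (y + v) l; rewrite !inE => /(_ Cx Cy).
suff -> : conv l (x + v : convex_lmodType V) (y + v) =
    conv l (x : convex_lmodType V) y + v by [].
by rewrite [RHS]shift_convex_comb.
Qed.

(** This makes the convexity of the epigraph another instance of
    [convex_set_shift], in the product space. *)
Lemma epi_shift f a : epi (f \o shift a) = shift (a, 0) @^-1` epi f.
Proof. by apply/seteqP; split=> -[y t]; rewrite /epi /= addr0. Qed.

Lemma is_convex_shift f a : is_convex f -> is_convex (f \o shift a).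
Proof.
move=> [cdom cepi]; split; first exact: convex_set_shift cdom.
by rewrite epi_shift; exact: convex_set_shift.
Qed.

(** Precomposing with a translation commutes definitionally with taking the
    opposite of the values. *)
Lemma is_concave_shift f a : is_concave f -> is_concave (f \o shift a).
Proof. exact: is_convex_shift. Qed.

Lemma is_affine_shift f a : is_affine f -> is_affine (f \o shift a).
Proof.
by move=> [fv fc]; split; [exact: is_convex_shift|exact: is_concave_shift].
Qed.

Lemma is_strictly_quasiconvex_shift f a :
  is_strictly_quasiconvex f -> is_strictly_quasiconvex (f \o shift a).
Proof.
move=> [cdom qf]; split; first exact: convex_set_shift cdom.
move=> y1 y2 c fy1 fy2 y12 c0 c1; rewrite /value /= shift_convex_comb.
by apply: qf => // /addIr.
Qed.

Lemma is_monotone_shift B f a :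
  is_monotone B f -> is_monotone B (f \o shift a).
Proof.
by move=> mf y1 y2 fy1 fy2 By; apply: mf => //=; rewrite opprD addrACA subrr addr0.
Qed.

Lemma is_strictly_monotone_shift B f a :
  is_strictly_monotone B f -> is_strictly_monotone B (f \o shift a).
Proof.
by move=> mf y1 y2 fy1 fy2 By; apply: mf => //=; rewrite opprD addrACA subrr addr0.
Qed.

End translation.

(** The topology of [subspace D] makes the points outside [D]
    isolated, so the claim has two cases; they match on both sides because
    [x] lies in [h @^-1` D] exactly when [h x] lies in [D]. *)
Lemma continuous_subspace_preimage (X Z : topologicalType) (h : X -> Z)
    (D : set Z) : continuous h ->
  continuous (h : subspace (h @^-1` D) -> subspace D).
Proof.
move=> hc x V.
rewrite -[nbhs _ V]/(nbhs_subspace (h x : subspace D) V).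
rewrite -[nbhs _ V]/(nbhs_subspace (x : subspace (h @^-1` D)) (h @^-1` V)).
have [Dhx|Dhx] := pselect (D (h x)).
  by rewrite -!nbhs_subspace_in//; exact: hc.
by rewrite -!nbhs_subspace_out// => Vhx y ->; exact: Vhx.
Qed.

Lemma lower_semicontinuous_comp (X Z : topologicalType) (R : realType)
    (h : X -> Z) (g : Z -> \bar R) :
  continuous h -> lower_semicontinuous g -> lower_semicontinuous (g \o h).
Proof.
move=> hc gl x r /gl[V Vhx gV].
by exists (h @^-1` V) => [|y]; [exact: hc|exact: gV].
Qed.

Lemma upper_semicontinuous_comp (X Z : topologicalType) (R : realType)
    (h : X -> Z) (g : Z -> \bar R) :
  continuous h -> upper_semicontinuous g -> upper_semicontinuous (g \o h).
Proof.
move=> hc gl x r /gl[V Vhx gV].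
by exists (h @^-1` V) => [|y]; [exact: hc|exact: gV].
Qed.

Section topological_translation.
Context {R : realType} {Y : topologicalLmodType R}.
Implicit Types (A : set Y) (f : Y -> option (\bar R)) (a : Y).

Lemma shift_continuous_tvs a : continuous (shift a : Y -> Y).
Proof.
move=> x; apply: (@continuous_comp _ _ _ (fun z => (z, a))
  (fun z : Y * Y => z.1 + z.2)); last exact: add_continuous.
by apply: cvg_pair; [exact: cvg_id|exact: cvg_cst].
Qed.

Lemma closed_translate a A : closed A -> closed (translate a A).
Proof.
rewrite translateE; apply: preimage_closed => x _; exact: shift_continuous_tvs.
Qed.

Let shift_subspace f a : continuous
    (shift a : subspace (dom (f \o shift a)) -> subspace (dom f)).
Proof. exact: (continuous_subspace_preimage (@shift_continuous_tvs a)). Qed.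

Lemma is_continuous_shift f a :
  is_continuous f -> is_continuous (f \o shift a).
Proof.
by move=> fc x; exact: (continuous_comp (@shift_subspace f a x) (fc _)).
Qed.

Lemma is_lower_semicontinuous_shift f a :
  is_lower_semicontinuous f -> is_lower_semicontinuous (f \o shift a).
Proof. exact: (lower_semicontinuous_comp (@shift_subspace f a)). Qed.

Lemma is_upper_semicontinuous_shift f a :
  is_upper_semicontinuous f -> is_upper_semicontinuous (f \o shift a).
Proof. exact: (upper_semicontinuous_comp (@shift_subspace f a)). Qed.

End topological_translation.

Theorem proposition7 (R : realType) (Y : topologicalLmodType R) (A : set Y)
    (k y0 : Y) (A_closed : closed A) (A_proper : proper_subset A)
    (hk : ((-%R @` recession_cone A) `\ 0) k) :
  closed (translate y0 A) /\
  proper_subset (translate y0 A) /\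
  ((-%R @` recession_cone (translate y0 A)) `\ 0) k /\
  dom (phi (translate y0 A) k) = translate y0 (dom (phi A k)) /\
  (forall y : Y, phi (translate y0 A) k y = phi A k (y - y0)) /\
  (is_proper (phi (translate y0 A) k) <-> is_proper (phi A k)) /\
  (is_finite_valued (phi (translate y0 A) k) <->
     is_finite_valued (phi A k)) /\
  (is_continuous (phi (translate y0 A) k) <-> is_continuous (phi A k)) /\
  (is_lower_semicontinuous (phi (translate y0 A) k) <->
     is_lower_semicontinuous (phi A k)) /\
  (is_upper_semicontinuous (phi (translate y0 A) k) <->
     is_upper_semicontinuous (phi A k)) /\
  (is_convex (phi (translate y0 A) k) <-> is_convex (phi A k)) /\
  (is_concave (phi (translate y0 A) k) <-> is_concave (phi A k)) /\
  (is_strictly_quasiconvex (phi (translate y0 A) k) <->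
     is_strictly_quasiconvex (phi A k)) /\
  (is_affine (phi (translate y0 A) k) <-> is_affine (phi A k)) /\
  (forall B : set Y,
     (is_monotone B (phi (translate y0 A) k) <->
        is_monotone B (phi A k)) /\
     (is_strictly_monotone B (phi (translate y0 A) k) <->
        is_strictly_monotone B (phi A k))).
Proof.
split; first exact: closed_translate.
split; first exact: proper_subset_translate.
split; first by rewrite recession_cone_translate.
rewrite phi_translate; split; first by rewrite translateE.
split=> //.
split; first exact: (shift_invariantP _ _ is_proper_shift).
split; first exact: (shift_invariantP _ _ is_finite_valued_shift).
split; first exact: (shift_invariantP _ _ is_continuous_shift).
split; first exact: (shift_invariantP _ _ is_lower_semicontinuous_shift).
split; first exact: (shift_invariantP _ _ is_upper_semicontinuous_shift).
split; first exact: (shift_invariantP _ _ is_convex_shift).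
split; first exact: (shift_invariantP _ _ is_concave_shift).
split; first exact: (shift_invariantP _ _ is_strictly_quasiconvex_shift).
split; first exact: (shift_invariantP _ _ is_affine_shift).
move=> B; split; first exact: (shift_invariantP _ _ (@is_monotone_shift _ _ B)).
exact: (shift_invariantP _ _ (@is_strictly_monotone_shift _ _ B)).
Qed.
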